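(* Let $G=(V,E)$ be a graph without isolated vertices and let $\beta$ be the cardinality of a minimum edge cover of $G$. For any edge weight $w$ and vertex measure $\mu$ on $G$, $$\beta\ge\max_{\sigma}\#\{k: L_k(\Gamma^\sigma)=0\},$$ where the maximum is over all signatures $\sigma:E\to\{+1,-1\}$ and $\Gamma^\sigma=(G,\sigma)$ (with the given $w$ and $\mu$).
   Context: $G=(V,E)$ is a finite undirected graph without self-loops, $V=\{1,\dots,n\}$. An edge cover is a set of edges such that every vertex is incident to at least one of them. A signed graph $(G,\sigma)$ has signature $\sigma:E\to\{\pm1\}$, edge weight $w:E\to(0,\infty)$, vertex measure $\mu:V\to(0,\infty)$, potential $\kappa:V\to\mathbb R$. For $p\ge1$ and nonzero $f$, $\mathcal R_p^\sigma(f)=\frac{\sum_{\{i,j\}\in E}w_{ij}|f(i)-\sigma_{ij}f(j)|^p+\sum_i\kappa_i|f(i)|^p}{\sum_i\mu_i|f(i)|^p}$; $\mathcal S_p=\{f:\sum_i\mu_i|f(i)|^p=1\}$; Krasnoselskii genus $\gamma(B)$ of closed symmetric $B\subset\mathbb R^n\setminus\{0\}$: least $k$ with an odd continuous map $B\to\mathbb R^k\setminus\{0\}$; $\mathcal F_k(\mathcal S_p)$ = closed symmetric $B\subset\mathcal S_p$ with $\gamma(B)\ge k$; $\lambda_k^{(p)}=\min_{B\in\mathcal F_k(\mathcal S_p)}\max_{f\in B}\mathcal R_p^\sigma(f)$. Cut-off adjacency eigenvalues: $L_k(\Gamma):=\lim_{p\to\infty}2^{-p}\lambda_k^{(p)}(\Gamma)$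 (limits exist, nonnegative, independent of $\kappa$). *)

(* Defs.v *)
From HB Require Import structures.
From mathcomp Require Import all_boot all_order all_algebra.
From mathcomp Require Import all_classical all_reals all_analysis.
Set Implicit Arguments. Unset Strict Implicit. Unset Printing Implicit Defensive.
Import Order.TTheory GRing.Theory Num.Theory.
Import numFieldNormedType.Exports.
Local Open Scope classical_set_scope.
Local Open Scope ring_scope.

Section SignedGraph.
Variables (R : realType) (n : nat).

(* The graph on V = 'I_n is a symmetric irreflexive relation [adj];
   each edge {i,j} is counted once, as the pair (i,j) with i < j.
   Functions f : V -> R are row vectors f : 'rV[R]_n, f(i) = f ord0 i. *)

Definition rq_num (adj : rel 'I_n) (w sigma : 'I_n -> 'I_n -> R)
  (kappa : 'I_n -> R) (p : R) (f : 'rV[R]_n) : R :=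
  \sum_(i < n) \sum_(j < n | ((i < j)%N && adj i j))
      w i j * (`|f ord0 i - sigma i j * f ord0 j| `^ p)
  + \sum_(i < n) kappa i * (`|f ord0 i| `^ p).

Definition rq_den (mu : 'I_n -> R) (p : R) (f : 'rV[R]_n) : R :=
  \sum_(i < n) mu i * (`|f ord0 i| `^ p).

Definition rayleigh adj w sigma kappa mu p f : R :=
  rq_num adj w sigma kappa p f / rq_den mu p f.

Definition Sp (mu : 'I_n -> R) (p : R) : set 'rV[R]_n :=
  [set f | rq_den mu p f = 1].

(* gamma(B) >= k, where gamma(B) is the least m admitting an odd
   continuous map B -> R^m \ {0} (and +infinity if there is none). *)
Definition genus_ge (B : set 'rV[R]_n) (k : nat) : Prop :=
  forall m : nat, (m < k)%N ->
    ~ exists g : 'rV[R]_n -> 'rV[R]_m,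
        [/\ {within B, continuous g},
            (forall x, B x -> g (- x) = - g x) &
            (forall x, B x -> g x != 0)].

Definition Fk (mu : 'I_n -> R) (p : R) (k : nat) : set (set 'rV[R]_n) :=
  [set B : set 'rV[R]_n | [/\ closed B, (forall x, B x -> B (- x)), B `<=` Sp mu p &
              genus_ge B k]].

(* lambda_k^(p) = min_{B in F_k} max_{f in B} R_p(f)  (written inf / sup) *)
Definition lambda_p adj w sigma kappa mu (p : R) (k : nat) : R :=
  inf [set sup [set rayleigh adj w sigma kappa mu p f | f in B] | B in Fk mu p k].

Definition cutoff_L adj w sigma kappa mu (k : nat) : R :=
  lim ((2 `^ (- p)) * lambda_p adj w sigma kappa mu p k @[p --> +oo]).

Definition is_edge_cover (adj : rel 'I_n) (C : {set 'I_n * 'I_n}) : bool :=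
  [forall e in C, (e.1 < e.2)%N && adj e.1 e.2] &&
  [forall v : 'I_n, [exists e in C, (e.1 == v) || (e.2 == v)]].

Definition edge_cover_number (adj : rel 'I_n) : nat :=
  \big[minn/(n * n)%N]_(C : {set 'I_n * 'I_n} | is_edge_cover adj C) #|C|.

End SignedGraph.

(* Main.v *)
Require Import Defs.
From HB Require Import structures.
From mathcomp Require Import all_boot all_order all_algebra.
From mathcomp Require Import all_classical all_reals all_analysis.
From mathcomp Require Import ring lra.
Import Order.TTheory GRing.Theory Num.Theory.
Import numFieldNormedType.Exports.
Local Open Scope ring_scope.

(**
A minimum edge cover C yields the linear odd map
f |-> (f(i) + sigma_ij f(j))_{ij in C} into R^|C|, so every set B of genus
larger than |C| contains some f with f(i) = - sigma_ij f(j) along the edges of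
C.  Since C touches every vertex, 2^{-p} R_p(f) is then bounded below by a
positive constant, up to O(2^{-p}).

Because [lim] returns the junk value 0 on a divergent function, convergence of
2^{-p} lambda_k^{(p)} has to be established as well.  The homeomorphism
f |-> sgn(f)|f|^{p/q} carries S_p to S_q and, by the power mean inequality,
2^{-q} R_q(f') <= 2^{-p} R_p(f) + O(2^{-p}) for its values f' when p <= q, so
the sequence is nonincreasing up to a vanishing error.

Likewise [inf] is 0 on the empty set, so F_k must be shown nonempty for k <= n;
this is the Borsuk-Ulam theorem.  It is proved with mod-2 simplicial cochains:
for antipodal sign functions s_0, ..., s_{m-1}, the cup product of the
coboundaries of the s_i evaluates to 1 on an iterated barycentric subdivision
of half of the m-dimensional cross-polytope boundary.  Hence some small simplex
(x_0, ..., x_m) has s_i(x_i) <> s_i(x_{i+1}) for all i; taking s_i = sign of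
g_i, this is impossible when g has no zero.
*)

Set Implicit Arguments.
Unset Strict Implicit.
Unset Printing Implicit Defensive.

(** * Mod-2 cochains and barycentric subdivision *)

Section Cochains.
Variable T : eqType.
Implicit Types (phi psi : seq T -> bool) (l : seq T).

(* Tuples are ordered and may repeat vertices; the complex is augmented, i.e. the
   boundary of [:: x] is [::]. *)
Fixpoint cobd phi l : bool :=
  if l is x :: l' then phi l' (+) cobd (fun z => phi (x :: z)) l' else false.

Lemma cobdD phi psi l :
  cobd (fun z => phi z (+) psi z) l = cobd phi l (+) cobd psi l.
Proof.
elim: l phi psi => //= x l IH phi psi; rewrite IH.
by case: (phi l) (psi l) (cobd _ l) (cobd _ l) => [] [] [] [].
Qed.

Lemma cobd0 l : cobd (fun=> false) l = false.
Proof. by elim: l => //= x l ->. Qed.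

Lemma cobd_cobd phi l : cobd (cobd phi) l = false.
Proof.
elim: l phi => //= x l IH phi.
by rewrite cobdD IH addbF addbb.
Qed.

(** [cobd] evaluates its argument only at faces of [l], so size and membership conditions pass
    through the inductions below. *)
Lemma eq_cobd phi psi l :
  (forall l', size l = (size l').+1 -> {subset l' <= l} -> phi l' = psi l') ->
  cobd phi l = cobd psi l.
Proof.
elim: l phi psi => //= x l IH phi psi H; congr addb.
  by apply: H => // y yl; rewrite inE yl orbT.
apply: IH => l' sl' sub; apply: H => [|y]; first by rewrite /= sl'.
by rewrite !inE => /orP[->//|/sub ->]; rewrite orbT.
Qed.

Lemma cobd_map (f : T -> T) phi l :
  cobd (fun z => phi (map f z)) l = cobd phi (map f l).
Proof. by elim: l phi => //= x l IH phi; rewrite -IH. Qed.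

End Cochains.

(** * Barycentric subdivision and evaluation on cross-polytope spheres *)

Section Subdivision.
Variables (R : realType) (V : normedModType R).
Implicit Types (phi psi : seq V -> bool) (l : seq V) (C : V -> Prop).

Definition barycenter l : V := (size l)%:R^-1 *: \sum_(x <- l) x.

(* The transpose of barycentric subdivision on tuples of size k: a simplex becomes
   the cone from its barycenter over its subdivided boundary.  The value on tuples
   of another size is meaningless. *)
Fixpoint sd k phi l : bool :=
  if k is k'.+1 then cobd (sd k' (fun z => phi (barycenter l :: z))) l
  else phi l.

Definition Sd phi l : bool := sd (size l) phi l.

Lemma sdD k phi psi l :
  sd k (fun z => phi z (+) psi z) l = sd k phi l (+) sd k psi l.
Proof.
elim: k phi psi l => //= k IH phi psi l; rewrite -cobdD.
by apply: eq_cobd => l' _ _; rewrite IH.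
Qed.

Lemma sd0 k l : sd k (fun=> false) l = false.
Proof.
elim: k l => //= k IH l; rewrite -[RHS](cobd0 l).
by apply: eq_cobd => l' _ _.
Qed.

(** The boundary of a cone is its base plus the cone over the boundary of the base; here the base is
    a subdivided boundary, so the second term dies by [cobd_cobd]. *)
Lemma sd_cobd k phi l : size l = k -> sd k (cobd phi) l = cobd (sd k.-1 phi) l.
Proof.
elim: k phi l => [|k IH] phi l sl /=; first by case: l sl.
transitivity (cobd (fun z => sd k phi z (+)
    cobd (sd k.-1 (fun z => phi (barycenter l :: z))) z) l).
  apply: eq_cobd => l' sl' _; rewrite sdD IH //.
  by move: sl'; rewrite sl => -[].
by rewrite cobdD cobd_cobd addbF.
Qed.

Lemma Sd_cobd phi : Sd (cobd phi) = cobd (Sd phi).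
Proof.
apply/funext => l; rewrite /Sd sd_cobd //.
by apply: eq_cobd => l' -> _.
Qed.

Lemma barycenterN l : barycenter (map -%R l) = - barycenter l.
Proof.
by rewrite /barycenter size_map big_map sumrN scalerN.
Qed.

Lemma sd_opp k phi l : sd k (fun z => phi (map -%R z)) l = sd k phi (map -%R l).
Proof.
elim: k phi l => //= k IH phi l; rewrite barycenterN -cobd_map.
by apply: eq_cobd => l' _ _; rewrite -IH.
Qed.

Lemma Sd_opp phi : Sd (fun z => phi (map -%R z)) = (fun l => Sd phi (map -%R l)).
Proof. by apply/funext => l; rewrite /Sd sd_opp size_map. Qed.

Lemma SdD phi psi :
  Sd (fun z => phi z (+) psi z) = (fun l => Sd phi l (+) Sd psi l).
Proof. by apply/funext => l; rewrite /Sd sdD. Qed.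

Definition bary_closed C :=
  forall l, l != [::] -> (forall x, x \in l -> C x) -> C (barycenter l).

Lemma sub_barycenter l (z : V) : l != [::] ->
  z - barycenter l = (size l)%:R^-1 *: \sum_(x <- l) (z - x).
Proof.
move=> l0; have s0 : (size l)%:R != 0 :> R by rewrite pnatr_eq0 size_eq0.
rewrite big_split /= sumrN scalerDr scalerN; congr (_ - _).
rewrite big_const_seq count_predT iter_addr_0.

by rewrite -[z *+ _]scaler_nat scalerA mulVf ?scale1r.
Qed.

Lemma barycenter_dist l (z : V) (d : R) : l != [::] ->
  (forall x, x \in l -> `|z - x| <= d) -> `|z - barycenter l| <= d.
Proof.
move=> l0 zl; have s0 : (size l)%:R != 0 :> R by rewrite pnatr_eq0 size_eq0.
rewrite sub_barycenter //.
rewrite normrZ ger0_norm ?invr_ge0 // -[leRHS](mulKf s0) ler_wpM2l ?invr_ge0 //.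
apply: le_trans (ler_norm_sum _ _ _) _.
rewrite mulr_natl -[X in d *+ X]count_predT -iter_addr_0 -big_const_seq.
by rewrite big_seq [leRHS]big_seq ler_sum.
Qed.

Definition tuple_in C (d : R) l :=
  (forall x, x \in l -> C x) /\ {in l &, forall x y, `|x - y| <= d}.

(** In the average of the differences x - y over [l] the term y = x vanishes, whence the factor 1 -
    1/size. *)
Lemma barycenter_contract l (x : V) (d r : R) : x \in l -> 0 <= d ->
  1 - (size l)%:R^-1 <= r ->
  {in l, forall y, `|x - y| <= d} -> `|x - barycenter l| <= r * d.
Proof.
move=> xl d0 rl dl.
have s0 : (0 < size l)%N by case: (l) xl.
have s0' : (size l)%:R != 0 :> R by rewrite pnatr_eq0 -lt0n.
rewrite sub_barycenter -?size_eq0 -?lt0n //.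
rewrite normrZ ger0_norm ?invr_ge0 //; apply: le_trans (ler_wpM2r d0 rl).
have -> : (1 - (size l)%:R^-1) * d = (size l)%:R^-1 * (d *+ (size l).-1).
  rewrite -[d *+ _]mulr_natl -subn1 natrB // mulrA; congr (_ * _); field.
  exact: s0'.
rewrite ler_wpM2l ?invr_ge0 // (big_rem x) //= subrr add0r.
apply: le_trans (ler_norm_sum _ _ _) _.
rewrite -(size_rem xl) -[X in d *+ X]count_predT -iter_addr_0 -big_const_seq.
by rewrite big_seq [leRHS]big_seq ler_sum // => y /mem_rem; exact: dl.
Qed.

(** Subdividing a simplex of diameter d reaches only simplices of diameter r d. The induction keeps
    d and shrinks C instead. *)
Lemma eq_sd k C (d r : R) phi psi : bary_closed C -> 0 <= d ->
  1 - k%:R^-1 <= r ->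
  (forall l, size l = k -> tuple_in C (r * d) l -> phi l = psi l) ->
  forall l, size l = k -> tuple_in C d l -> sd k phi l = sd k psi l.
Proof.
elim: k C d phi psi => [|k IH] C d phi psi clC d0 rk H l sl [Cl dl] /=.
  apply: H => //; case: l sl {Cl dl} => // _; split => //.
apply: eq_cobd => l'; rewrite sl => -[sl'] sub.
have l0 : l != [::] by rewrite -size_eq0 sl.
pose b := barycenter l.
(* Size 1 is separate: as 0^-1 = 0, the induction hypothesis at size 0 would demand 1 <= r. *)
case: k => [|k] in IH rk H sl sl' *.
  case: l' sl' sub => // _ _ /=; apply: H => //; split => [x|x y]; rewrite !inE.
    by move=> /eqP->; apply: clC.
  move=> /eqP-> /eqP->; rewrite subrr normr0 mulr_ge0 //.
  by apply: le_trans rk; rewrite invr1 subrr.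
have rd : {in l, forall x, `|b - x| <= r * d}.
  move=> x xl; rewrite distrC barycenter_contract ?sl // => y yl; exact: dl.
(* Closeness to b, once put into C, holds for all later barycenters, so prepending b keeps the
   diameter within r d. *)
apply: (IH (fun x => C x /\ `|b - x| <= r * d) d) => //.
- move=> m m0 Cm; split; first by apply: clC => // x /Cm[].
  by apply: barycenter_dist => // x /Cm[].
- apply: le_trans rk; rewrite lerB // lef_pV2 ?posrE ?ltr0n // ler_nat.
  by rewrite ltnW.
- move=> m sm [Cm dm]; apply: H; first by rewrite /= sm.
  split => [x|x y]; rewrite !inE.
    by move=> /orP[/eqP->|/Cm[]//]; apply: clC.
  have r0 : 0 <= r * d.
    apply: (le_trans (normr_ge0 _) (rd (head 0 l) _)).
    by case: (l) l0 => //= ? ? _; rewrite mem_head.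
  move=> /orP[/eqP->|xm] /orP[/eqP->|ym].
  + by rewrite subrr normr0.
  + by have [] := Cm _ ym.
  + by rewrite distrC; have [] := Cm _ xm.
  + exact: dm.
- split => [x /sub xl|x y /sub xl /sub yl]; last exact: dl.
  by split; [exact: Cl|exact: rd].
Qed.

Lemma eq_iter_Sd k C (d r : R) N phi psi : bary_closed C -> 0 <= d ->
  1 - k%:R^-1 <= r -> 0 <= r ->
  (forall l, size l = k -> tuple_in C (r ^+ N * d) l -> phi l = psi l) ->
  forall l, size l = k -> tuple_in C d l -> iter N Sd phi l = iter N Sd psi l.
Proof.
move=> clC d0 rk r0; elim: N d d0 => [|N IH] d d0 H l sl Cl /=.
  by apply: H; rewrite ?mul1r.
rewrite /Sd sl; apply: (eq_sd clC d0 rk) => // m sm Cm.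
apply: IH Cm => //; first by rewrite mulr_ge0.
by move=> m' sm' Cm'; apply: H => //; rewrite exprSr -mulrA.
Qed.

Lemma iter_Sd_cobd N phi : iter N Sd (cobd phi) = cobd (iter N Sd phi).
Proof. by elim: N => //= N ->; rewrite Sd_cobd. Qed.

Lemma iter_Sd_opp N phi :
  iter N Sd (fun z => phi (map -%R z)) = (fun l => iter N Sd phi (map -%R l)).
Proof. by elim: N => //= N ->; rewrite Sd_opp. Qed.

Lemma iter_SdD N phi psi :
  iter N Sd (fun z => phi z (+) psi z) =
  (fun l => iter N Sd phi l (+) iter N Sd psi l).
Proof. by elim: N => //= N ->; rewrite SdD. Qed.

(* Evaluation on the fundamental cycle of the boundary of the cross-polytope with
   vertices +-e for e in E; cap_ev (e :: E) uses only the half containing e, whose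
   boundary is the sphere on E. *)
Fixpoint sphere_ev (E : seq V) phi : bool :=
  if E is e :: E' then
    sphere_ev E' (fun l => phi (e :: l)) (+)
    sphere_ev E' (fun l => phi (map -%R (e :: l)))
  else phi [::].

Definition cap_ev (E : seq V) phi : bool :=
  if E is e :: E' then sphere_ev E' (fun l => phi (e :: l)) else false.

Lemma sphere_evD E phi psi :
  sphere_ev E (fun l => phi l (+) psi l) = sphere_ev E phi (+) sphere_ev E psi.
Proof.
elim: E phi psi => //= e E IH phi psi; rewrite !IH.
move: (sphere_ev _ _) (sphere_ev _ _) (sphere_ev _ _) (sphere_ev _ _).
by case=> [] [] [] [].
Qed.

Lemma sphere_ev_cap E phi : E != [::] ->
  sphere_ev E phi = cap_ev E (fun l => phi l (+) phi (map -%R l)).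
Proof. by case: E => //= e E _; rewrite sphere_evD. Qed.

Lemma sphere_ev_opp E phi :
  sphere_ev E (fun l => phi (map -%R l)) = sphere_ev E phi.
Proof.
case: E => //= e E; rewrite addbC; congr addb; congr sphere_ev.
by apply/funext => l; rewrite opprK mapK //; exact: opprK.
Qed.

(** The sphere is a cycle: dropping the apex e or -e leaves the same sphere on E up to the antipode,
    and these two terms cancel. *)
Lemma sphere_ev_cobd E phi : sphere_ev E (cobd phi) = false.
Proof.
elim: E phi => //= e E IH phi; rewrite sphere_evD IH addbF.
under [X in _ (+) sphere_ev _ X]eq_fun do rewrite -cobd_map.
by rewrite sphere_evD IH addbF sphere_ev_opp addbb.
Qed.

(** Stokes on the hemisphere with apex e; the side faces cancel because the equator is a cycle. *)
Lemma cap_ev_cobd e E phi : cap_ev (e :: E) (cobd phi) = sphere_ev E phi.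
Proof. by rewrite /= sphere_evD sphere_ev_cobd addbF. Qed.

End Subdivision.

(** * Cup products of sign coboundaries *)

Section SignCochain.
Variables (R : realType) (V : normedModType R) (J : eqType) (s : J -> V -> bool).

(** The cup product of the 0-cochain f with phi. *)
Definition sign_mul (f : V -> bool) (phi : seq V -> bool) (l : seq V) : bool :=
  if l is x :: _ then f x && phi l else false.

(* The iterated cup product of the coboundaries of the s_j, see sign_cochain_cons. *)
Fixpoint sign_cochain (S : seq J) : seq V -> bool :=
  if S is j :: S' then cobd (sign_mul (s j) (sign_cochain S'))
  else fun l => size l == 1%N.

Lemma cobd_sign_cochain S l : cobd (sign_cochain S) l = false.
Proof.
case: S => [|j S]; last exact: cobd_cobd.
case: l => [|x [|y [|z l]]] //=; rewrite -[RHS](cobd0 l).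
by apply: eq_cobd.
Qed.

(** Leibniz rule for the cup product; the other term drops out because the remaining product is a
    cocycle. *)
Lemma sign_cochain_cons j S x y l :
  sign_cochain (j :: S) (x :: y :: l) =
  (s j x (+) s j y) && sign_cochain S (y :: l).
Proof.
have := cobd_sign_cochain S (x :: y :: l); rewrite /=.
set phi := sign_cochain S.
have -> : cobd (fun z => s j x && phi [:: x, y & z]) l =
          s j x && cobd (fun z => phi [:: x, y & z]) l.
  by case: (s j x) => //=; rewrite cobd0.
by case: (s j x) (s j y) (phi (y :: l)) (phi (x :: l)) (cobd _ l)
  => [] [] [] [] [].
Qed.

Lemma sign_cochain_const S j l : j \in S ->
  {in l &, forall x y, s j x = s j y} -> sign_cochain S l = false.
Proof.
elim: S l => // i S IH l; rewrite inE => /orP ij cl.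
case: l cl => // x [|y l] // cl; rewrite sign_cochain_cons.
case: ij => [/eqP<-|jS].
  by rewrite (cl x y) ?addbb ?inE ?eqxx ?orbT.
by rewrite IH ?andbF // => a b al bl; apply: cl; rewrite inE ?al ?bl orbT.
Qed.

Hypothesis s_opp : forall j x, x != 0 -> s j (- x) = ~~ s j x.

Lemma sign_cochain_opp S (l : seq V) : (forall x, x \in l -> x != 0) ->
  sign_cochain S (map -%R l) = sign_cochain S l.
Proof.
elim: S l => [|j S IH] l l0; first by rewrite /= size_map.
case: l l0 => // x [|y l] // l0.
rewrite [map _ _]/= !sign_cochain_cons !s_opp ?l0 ?inE ?eqxx ?orbT //.
rewrite -[- y :: _]/(map -%R (y :: l)) IH => [|z zl]; last by rewrite l0 // inE zl orbT.
by rewrite addbN addNb negbK.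
Qed.

(** s_j and its antipode sum to 1 mod 2, so the antipodal sum strips off the factor s_j. This lowers
    the dimension in [cap_ev_sign]. *)
Lemma sign_mul_opp S j (l : seq V) : (forall x, x \in l -> x != 0) -> l != [::] ->
  sign_mul (s j) (sign_cochain S) l (+)
  sign_mul (s j) (sign_cochain S) (map -%R l) = sign_cochain S l.
Proof.
case: l => // x l l0 _; rewrite [map _ _]/=.
rewrite /sign_mul -[- x :: _]/(map -%R (x :: l)) sign_cochain_opp // s_opp ?l0 ?inE ?eqxx //.
by case: (s j x); case: (sign_cochain _ _).
Qed.

End SignCochain.

(** * Sign changes on a subdivided cross-polytope *)

Section CrossPolytope.
Variables (R : realType) (n : nat).
Local Notation V := 'rV[R]_n.
Local Notation e := (fun i : 'I_n => delta_mx 0 i : V).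

Lemma eq_sphere_ev (I : seq 'I_n) (phi psi : seq V -> bool) : uniq I ->
  (forall u : 'I_n -> R, (forall i, `|u i| = 1) ->
     phi [seq u i *: e i | i <- I] = psi [seq u i *: e i | i <- I]) ->
  sphere_ev (map e I) phi = sphere_ev (map e I) psi.
Proof.
elim: I phi psi => [|i I IH] phi psi /=.
  by move=> _ H; apply: (H (fun=> 1)) => _; rewrite normr1.
move=> /andP[iI uI] H; congr addb; apply: IH => // u u1.
  have := H (fun j => if j == i then 1 else u j) _; rewrite eqxx scale1r.
  have -> : [seq (if j == i then 1 else u j) *: e j | j <- I] = [seq u j *: e j | j <- I].
    by apply/eq_in_map => j jI; case: eqP => // ji; rewrite -ji jI in iI.
  by apply => j; case: eqP; rewrite ?normr1.
have := H (fun j => if j == i then -1 else - u j) _; rewrite eqxx scaleN1r -map_comp.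
have -> : [seq (if j == i then -1 else - u j) *: e j | j <- I] = [seq - (u j *: e j) | j <- I].
  by apply/eq_in_map => j jI; case: eqP => [ji|_]; [rewrite -ji jI in iI|rewrite scaleNr].
by apply => j; case: eqP; rewrite ?normrN ?normr1.
Qed.

(** A compact set avoiding 0 that contains the cross-polytope boundary; the norm is the maximum
    norm. *)
Definition shell (x : V) := `|x| <= 1 /\ 1 <= n%:R * `|x|.

Lemma shell_neq0 x : shell x -> x != 0.
Proof.
by case=> _; apply: contraTneq => ->; rewrite normr0 mulr0 -ltNge ltr01.
Qed.

Lemma normrV_coord (x : V) i : `|x 0 i| <= `|x|.
Proof.
rewrite [leRHS]mx_normrE.
exact: (@le_bigmax _ _ _ 0 (fun ij : 'I_1 * 'I_n => `|x ij.1 ij.2|) (0, i)).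
Qed.

Lemma norm_delta i : `|e i| = 1.
Proof.
apply/eqP; rewrite eq_le; apply/andP; split.
  rewrite [leLHS]mx_normrE; apply/bigmax_leP; split => // -[a b] _ /=.
  by rewrite mxE; case: andP; rewrite ?normr1 ?normr0.
by apply: le_trans (normrV_coord _ i); rewrite mxE !eqxx normr1.
Qed.

(** For |u_i| = 1, a convex subset of [shell] containing the facet with vertices u_i e_i; convexity
    lets it follow the subdivision. *)
Let cap (u : 'I_n -> R) (x : V) := `|x| <= 1 /\ \sum_i u i * x 0 i = 1.

Let cap_bary u : bary_closed (cap u).
Proof.
move=> l l0 Cl; split.
  rewrite -normrN -sub0r; apply: barycenter_dist => // x /Cl[+ _].
  by rewrite sub0r normrN.
have s0 : (size l)%:R != 0 :> R by rewrite pnatr_eq0 size_eq0.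
transitivity ((size l)%:R^-1 * \sum_(x <- l) \sum_i u i * x 0 i : R).
  rewrite exchange_big /= mulr_sumr; apply: eq_bigr => i _.
  by rewrite mxE summxE -mulr_sumr mulrCA.
apply: (mulfI s0); rewrite mulVKf // mulr1 big_seq (eq_bigr (fun=> 1)) => [|x /Cl[]//].
by rewrite -big_seq big_const_seq count_predT iter_addr_0.
Qed.

Let cap_shell u x : (forall i, `|u i| = 1) -> cap u x -> shell x.
Proof.
move=> u1 [x1 ux]; split=> //; rewrite -{1}[1]normr1 -{1}ux.
apply: le_trans (ler_norm_sum _ _ _) _; rewrite mulr_natl.
rewrite -[X in _ *+ X]card_ord -sumr_const ler_sum // => i _.
by rewrite normrM u1 mul1r normrV_coord.
Qed.

Lemma eq_cap_ev N (I : seq 'I_n) (phi psi : seq V -> bool) : uniq I ->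
  (forall l, size l = size I ->
     tuple_in shell ((1 - (size I)%:R^-1) ^+ N * 2) l -> phi l = psi l) ->
  cap_ev (map e I) (iter N (@Sd R V) phi) = cap_ev (map e I) (iter N (@Sd R V) psi).
Proof.
case: I => [|i I] //= /andP[iI uI] H.
apply: eq_sphere_ev => // u u1.
pose u' j := if j == i then 1 else u j.
have u'1 j : `|u' j| = 1 by rewrite /u'; case: eqP; rewrite ?normr1.
have -> : delta_mx 0 i :: [seq u j *: e j | j <- I] = [seq u' j *: e j | j <- i :: I].
  rewrite /= {1}/u' eqxx scale1r; congr cons.
  by apply/eq_in_map => j jI; rewrite /u'; case: eqP => // ji; rewrite -ji jI in iI.
apply: (eq_iter_Sd (C := cap u') (k := (size I).+1) (d := 2)
  (r := (1 - (size I).+1%:R^-1))); rewrite ?size_map //.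
- by rewrite subr_ge0 invf_le1 ?ltr0n // ler1n.
- move=> l sl [Cl dl]; apply: H => //; split => // x /Cl; exact: cap_shell.
- have Ce j : cap u' (u' j *: e j).
    rewrite /cap normrZ u'1 norm_delta mulr1; split => //.
    rewrite (bigD1 j) //= big1 => [|k kj]; last first.
      by rewrite !mxE eqxx (negbTE kj) !mulr0.
    by rewrite !mxE !eqxx addr0 mulr1 -expr2 -real_normK ?num_real // u'1 expr1n.
  split => [x /mapP[j _ ->]//|x y /mapP[j _ ->] /mapP[k _ ->]].
  apply: le_trans (ler_normB _ _) _.
  by rewrite !normrZ !u'1 !norm_delta !mulr1.
Qed.

(** Induction on S: Stokes moves the evaluation to the sphere bounding the cap, which folds to an
    antipodal sum on a lower cap, that is, the same claim without j. The base case is a single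
    vertex. *)
Lemma cap_ev_sign N m (s : 'I_m -> V -> bool) (S : seq 'I_m) (I : seq 'I_n) :
  (forall j x, x != 0 -> s j (- x) = ~~ s j x) ->
  uniq I -> size I = (size S).+1 ->
  cap_ev (map e I) (iter N (@Sd R V) (sign_cochain s S)).
Proof.
move=> s_opp; elim: S I => [|j S IH] [|i I] //= /andP[iI uI] [sI].
  case: I iI uI sI => //= _ _ _.
  elim: N (e i) => //= N IHN x.
  by rewrite /Sd /= addbF IHN.
have I0 : map e I != [::] by case: (I) sI.
have := cap_ev_cobd (e i) (map e I) (iter N (@Sd R V) (sign_mul (s j) (sign_cochain s S))).
rewrite -iter_Sd_cobd sphere_ev_cap //= => ->.
set f := sign_mul _ _.
have -> : (fun l => iter N (@Sd R V) f l (+) iter N (@Sd R V) f (map -%R l)) =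
    iter N (@Sd R V) (fun l => f l (+) f (map -%R l)).
  by rewrite iter_SdD iter_Sd_opp.
(* The antipodal identity requires nonzero vertices; those of the subdivided cap lie in [shell]. *)
rewrite (@eq_cap_ev N I _ (sign_cochain s S)) //; first exact: IH.
move=> l sl [Kl _]; apply: sign_mul_opp => //.
  by move=> x /Kl; exact: shell_neq0.
by rewrite -size_eq0 sl sI.
Qed.

(** Otherwise the sign cochain would vanish on all small tuples and evaluate to 0 on a fine enough
    subdivision, against [cap_ev_sign]. *)
Lemma antipodal_tuple m (s : 'I_m -> V -> bool) (d : R) : (m < n)%N -> 0 < d ->
  (forall j x, x != 0 -> s j (- x) = ~~ s j x) ->
  exists l, [/\ tuple_in shell d l, size l = m.+1 &
    forall j, exists x y, [/\ x \in l, y \in l & s j x != s j y]].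
Proof.
move=> mn d0 s_opp.
have [N Nd] : exists N, (1 - m.+1%:R^-1) ^+ N * 2 <= d.
  have z1 : `|1 - m.+1%:R^-1 : R| < 1.
    have m0 : 0 < m.+1%:R^-1 :> R by rewrite invr_gt0 ltr0n.
    have m1 : m.+1%:R^-1 <= 1 :> R by rewrite invf_le1 ?ltr0n // ler1n.
    by rewrite ger0_norm ?subr_ge0 // gtrBl.
  have /cvgrPdist_lt/(_ (d / 2)) := cvg_expr z1.
  rewrite divr_gt0 // => /(_ isT)[N _ /(_ N (leqnn N))] /=.
  rewrite sub0r normrN => /ltW/(le_trans (ler_norm _)) dN.
  by exists N; rewrite -ler_pdivlMr.
pose I := [seq widen_ord mn i | i <- enum 'I_m.+1].
have uI : uniq I.
  rewrite map_inj_uniq ?enum_uniq // => i j /(congr1 val) /= ij.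
  exact: val_inj.
have sI : size I = m.+1 by rewrite size_map size_enum_ord.
have := cap_ev_sign N (S := enum 'I_m) s_opp uI.
rewrite sI size_enum_ord => /(_ erefl) ev1; apply: contrapT => nl.
suff : cap_ev (map e I) (iter N (@Sd R V) (sign_cochain s (enum 'I_m))) = false.
  by rewrite ev1.
have iter0 : iter N (@Sd R V) (fun=> false) = (fun=> false).
  by elim: (N) => //= k ->; apply/funext => l; rewrite /Sd sd0.
have sph0 (E : seq V) : sphere_ev E (fun=> false) = false.
  by elim: E => //= a E ->.
rewrite (@eq_cap_ev N I _ (fun=> false)) // ?iter0.
  by case: (map _ _) => //= a E; exact: sph0.
move=> l; rewrite sI => sl Kl; apply/negbTE/negP => W; apply: nl.
exists l; split => //.
  by case: Kl => K1 K2; split => // x y xl yl; apply: le_trans Nd; exact: K2.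
move=> j; apply: contrapT => nj.
suff : sign_cochain s (enum 'I_m) l = false by rewrite W.
apply: (@sign_cochain_const _ _ _ _ _ j); rewrite ?mem_enum // => x y xl yl.
by apply/eqP/negPn/negP => sxy; apply: nj; exists x, y.
Qed.
End CrossPolytope.

(** * The Borsuk-Ulam theorem *)

Section BorsukUlam.
Local Open Scope classical_set_scope.
Variable R : realType.

Lemma cvg_rV (T : Type) (F : set_system T) (FF : Filter F) m (f : T -> 'rV[R]_m)
    (y : 'rV[R]_m) :
  (forall j, f x 0 j @[x --> F] --> y 0 j) -> f x @[x --> F] --> y.
Proof.
move=> H A [P Py PA]; rewrite nbhs_simpl /=.
have : \forall x \near F, forall j, P 0 j (f x 0 j).
  by apply: filter_forall => j; exact: H (Py 0 j).
by apply: filterS => x Px; apply: PA => i j; rewrite (ord1 i).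
Qed.

(** An odd tie-break: the chosen coordinate depends only on the support, hence is the same for y and
    -y. *)
Definition lead_pos m (y : 'rV[R]_m) : bool :=
  if [pick i | y 0 i != 0] is Some i then 0 < y 0 i else false.

Lemma lead_posN m (y : 'rV[R]_m) : y != 0 -> lead_pos (- y) = ~~ lead_pos y.
Proof.
move=> y0; rewrite /lead_pos.
rewrite (@eq_pick _ _ (fun i => y 0 i != 0)) => [|i]; last by rewrite mxE oppr_eq0.
case: pickP => [i yi|y0']; first by rewrite mxE oppr_gt0 -leNgt le_eqVlt (negbTE yi).
case/eqP: y0; apply/rowP => i; rewrite mxE.
by apply/eqP; rewrite -[_ == _]negbK; rewrite y0'.
Qed.

Theorem borsuk_ulam n m (g : 'rV[R]_n -> 'rV[R]_m) : (m < n)%N ->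
  (forall x : 'rV[R]_n, x != 0 -> {for x, continuous g}) ->
  (forall x : 'rV[R]_n, x != 0 -> g (- x) = - g x) ->
  exists2 x : 'rV[R]_n, x != 0 & g x = 0.
Proof.
move=> mn gc gN; apply: contrapT => H.
have g0 (x : 'rV[R]_n) : x != 0 -> g x != 0.
  by move=> x0; apply/eqP => gx; apply: H; exists x.
(* Thanks to the tie-break s_j is antipodal even where g_j vanishes; it is locally constant where
   g_j does not. *)
pose s (j : 'I_m) x := if g x 0 j == 0 then lead_pos (g x) else 0 < g x 0 j.
have sN j (x : 'rV[R]_n) : x != 0 -> s j (- x) = ~~ s j x.
  move=> x0; rewrite /s gN // mxE oppr_eq0 lead_posN ?g0 //.
  by case: ifP => // /negbT gx; rewrite oppr_gt0 -leNgt le_eqVlt (negbTE gx).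
have s_near (x : 'rV[R]_n) : x != 0 -> exists j, \forall y \near x, s j y = s j x.
  move=> x0; have /eqP/rowP/existsNP[j] := g0 x x0; rewrite mxE => /eqP gxj.
  have cj : (g y 0 j) @[y --> x] --> g x 0 j.
    apply: (@continuous_comp _ _ _ g (fun M : 'rV[R]_m => M 0 j)).
      exact: gc.
    exact: coord_continuous.
  exists j; have [gp|gn|g_0] := ltgtP (g x 0 j) 0; last by rewrite g_0 eqxx in gxj.
  - apply: filterS (cvgr_lt _ cj _ gp) => y gy.
    by rewrite /s (negbTE gxj) lt_eqF // !ltNge !ltW.
  - apply: filterS (cvgr_gt _ cj _ gn) => y gy.
    by rewrite /s (negbTE gxj) gt_eqF // gy gn.
have cK : compact (@shell R n).
  apply: bounded_closed_compact.
    exists 1; split => // M M1 x [x1 _] /=; exact: le_trans x1 (ltW M1).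
  have -> : @shell R n = (fun x => `|x|) @^-1` [set t | t <= 1] `&`
      (fun x => n%:R * `|x|) @^-1` [set t | 1 <= t] by [].
  apply: closedI; apply: closed_comp => //.
  - by move=> x _; exact: norm_continuous.
  - by move=> x _; apply: (cvgM (cvg_cst _) (@norm_continuous _ _ x)).
(* A Lebesgue number: by compactness one d serves all points of the shell, while j depends on the
   point. *)
have [d d0 Hd] : exists2 d : R, 0 < d & forall x, shell x ->
    exists j, forall y, shell y -> `|x - y| <= d -> s j y = s j x.
  move/compact_near_coveringP : cK => /(_ R (0^'+)%R (fun d x =>
     exists j, forall y, shell y -> `|x - y| <= d -> s j y = s j x)) near_cover.
  have {}/near_cover : forall x, shell x -> \forall x' \near x & d \near (0^'+)%R,
      exists j, forall y, shell y -> `|x' - y| <= d -> s j y = s j x'.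
    move=> x /shell_neq0/s_near[j /nbhs_ballP[e /= e0 He]].
    exists (ball x (e / 2), [set d | d < e / 2]).
      split; first by apply: nbhsx_ballx; rewrite divr_gt0.
      by apply: nbhs_right_lt; rewrite divr_gt0.
    move=> [x' d] [/= xx' de]; exists j => /= y Ky xy.
    have e2 : ball x e x'.
      by apply: le_ball xx'; lra.
    rewrite (He x') // He // -ball_normE /=.
    move: xx'; rewrite -ball_normE /= => xx'.
    have := ler_distD x' x y; lra.
  move=> near_d; near ((0 : R)^'+) => d.
  by exists d; near: d; [exact: nbhs_right_gt|exact: near_d].
have [l [[Kl dl] sl Hl]] := @antipodal_tuple R n m s d mn d0 sN.
case: l sl Kl dl Hl => // x l sl Kl dl Hl.
(* The index attached to the first vertex is constant on the whole tuple, against the sign change at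
   every index. *)
have [j Hj] := Hd x (Kl _ (mem_head _ _)).
have [y [z [yl zl /eqP[]]]] := Hl j.
have Hx v : v \in x :: l -> s j v = s j x.
  by move=> vl; apply: Hj; [exact: Kl|apply: dl => //; exact: mem_head].
by rewrite !Hx.
Unshelve. all: by end_near. Qed.
End BorsukUlam.

(** * The spheres S_p and their genus *)

Section SignedPower.
Local Open Scope classical_set_scope.
Variable R : realType.
Implicit Types (r s x : R).

Lemma continuous_abs_powR r : 0 < r -> continuous (fun x : R => `|x| `^ r).
Proof.
move=> r0 x; have [->|x0] := eqVneq x 0.
  apply/cvgrPdist_lt => e e0; rewrite normr0 powR0 ?gt_eqF //.
  have er : 0 < e `^ r^-1 by rewrite powR_gt0.
  apply/nbhs_ballP; exists (e `^ r^-1) => //= y; rewrite /ball_ /= !sub0r !normrN => ye.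
  rewrite ger0_norm ?powR_ge0 //.
  have : `|y| `^ r < (e `^ r^-1) `^ r by apply: gt0_ltr_powR; rewrite // nnegrE powR_ge0.
  by rewrite -powRrM mulVf ?gt_eqF // powRr1 ?ltW.
apply: (@continuous_comp R R R (fun x : R => `|x|) (fun t : R => t `^ r)).
  exact: norm_continuous.
apply/differentiable_continuous/derivable1_diffP/derivable_powR.
by rewrite in_itv /= andbT normr_gt0.
Qed.

(* sgn(x) |x|^r, in a form whose continuity is immediate. *)
Definition spow r x : R := `|Num.max x 0| `^ r - `|Num.max (- x) 0| `^ r.

Lemma spow_continuous r : 0 < r -> continuous (spow r).
Proof.
have max0c : continuous (fun y : R => Num.max y 0).
  have -> : (fun y : R => Num.max y 0) = (fun y => (y + `|y|) * 2^-1).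
    by apply/funext => y; rewrite maxr_absE subr0 addr0.
  move=> y; exact: (cvgM (cvgD cvg_id (@norm_continuous _ _ y)) (cvg_cst _)).
move=> r0 x; apply: cvgB.
  apply: (@continuous_comp _ _ _ (fun y : R => Num.max y 0) (fun t => `|t| `^ r)).
    exact: max0c.
  exact: continuous_abs_powR.
apply: (@continuous_comp _ _ _ (fun y : R => Num.max (- y) 0) (fun t => `|t| `^ r)).
  apply: (@continuous_comp R R R (fun y : R => - y) (fun y : R => Num.max y 0)); last exact: max0c.
  exact: opp_continuous.
exact: continuous_abs_powR.
Qed.

Lemma spowN r x : spow r (- x) = - spow r x.
Proof. by rewrite /spow opprK opprB. Qed.

Lemma spow_ge0 r x : 0 < r -> 0 <= x -> spow r x = x `^ r.
Proof.
move=> r0 x0; rewrite /spow max_l // max_r ?oppr_le0 // normr0 powR0 ?gt_eqF //.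
by rewrite subr0 ger0_norm.
Qed.

Lemma spowE r x : 0 < r -> spow r x = Num.sg x * `|x| `^ r.
Proof.
move=> r0; have [x0|x0] := leP 0 x.
  rewrite spow_ge0 // ger0_norm //; case: (ltgtP 0 x) x0 => // [x0 _|<- _].
    by rewrite gtr0_sg ?mul1r.
  by rewrite powR0 ?gt_eqF // mulr0.
by rewrite -[x in LHS]opprK spowN spow_ge0 ?oppr_ge0 ?ltW // ltr0_sg // ltr0_norm // mulN1r.
Qed.

Lemma abs_spow r x : 0 < r -> `|spow r x| = `|x| `^ r.
Proof.
move=> r0; rewrite spowE // normrM normr_sg (ger0_norm (powR_ge0 _ _)).
by case: eqP => [->|]; rewrite ?mul1r // normr0 powR0 ?gt_eqF // mulr0.
Qed.

Lemma spow_spow r s x : 0 < r -> 0 < s -> r * s = 1 -> spow r (spow s x) = x.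
Proof.
move=> r0 s0 rs; have pos y : 0 <= y -> spow r (spow s y) = y.
  by move=> y0; rewrite (spow_ge0 s0) // spow_ge0 ?powR_ge0 // -powRrM mulrC rs powRr1.
have [x0|x0] := leP 0 x; first exact: pos.
by have := pos (- x); rewrite !spowN oppr_ge0 => /(_ (ltW x0))/oppr_inj.
Qed.

End SignedPower.

(** * Genus of S_p and transport between exponents *)

Section Genus.
Local Open Scope classical_set_scope.
Variables (R : realType) (n : nat).
Local Notation V := 'rV[R]_n.
Variable mu : 'I_n -> R.
Hypothesis mu_pos : forall i, 0 < mu i.

Lemma cvg_within_comp (T U W : topologicalType) (F : set_system T) (FF : Filter F)
    (A : set U) (f : T -> U) (g : U -> W) (y : U) :
  f x @[x --> F] --> y -> (\forall x \near F, A (f x)) -> A y ->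
  {within A, continuous g} -> g (f x) @[x --> F] --> g y.
Proof.
move=> fy fA Ay /subspace_continuousP/(_ y Ay) gy P /gy gP.
apply: filterS2 fA (fy _ gP) => x Ax; exact.
Qed.

Lemma rq_den_ge0 p (f : V) : 0 <= rq_den mu p f.
Proof. by apply: sumr_ge0 => i _; rewrite mulr_ge0 ?powR_ge0 // ltW. Qed.

Lemma rq_den_gt0 p (f : V) : f != 0 -> 0 < rq_den mu p f.
Proof.
move=> f0; have /eqP/rowP/existsNP[i] := f0; rewrite mxE => /eqP fi.
rewrite /rq_den (bigD1 i) //= ltr_wpDr ?mulr_gt0 ?powR_gt0 ?normr_gt0 //.
by apply: sumr_ge0 => j _; rewrite mulr_ge0 ?powR_ge0 // ltW.
Qed.

Lemma rq_denZ p c (f : V) : rq_den mu p (c *: f) = `|c| `^ p * rq_den mu p f.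
Proof.
rewrite /rq_den mulr_sumr; apply: eq_bigr => i _.
by rewrite mxE normrM powRM // mulrCA.
Qed.

Lemma rq_den_continuous p : 0 < p -> continuous (rq_den mu p : V -> R).
Proof.
move=> p0; apply: continuous_big => [|i _ x]; first exact: add_continuous.
have cf : {for x, continuous (fun f : V => `|f 0 i| `^ p)}.
  apply: (@continuous_comp V R R (fun f : V => f 0 i) (fun t : R => `|t| `^ p)).
    exact: coord_continuous.
  exact: continuous_abs_powR.
exact: (cvgM (cvg_cst _) cf).
Qed.

Lemma Sp_closed p : 0 < p -> closed (Sp mu p : set V).
Proof.
move=> p0; apply: (@closed_comp _ _ (rq_den mu p) [set 1]); last exact: closed_eq.
by move=> x _; exact: rq_den_continuous.
Qed.

Lemma rq_denN p (f : V) : rq_den mu p (- f) = rq_den mu p f.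
Proof. by apply: eq_bigr => i _; rewrite mxE normrN. Qed.

Lemma SpN p (f : V) : Sp mu p f -> Sp mu p (- f).
Proof. by rewrite /Sp /= rq_denN. Qed.

(** Radial normalisation extends an odd nonvanishing map on S_p to all nonzero vectors, where
    [borsuk_ulam] forbids it. *)
Lemma Sp_genus p k : 0 < p -> (k <= n)%N -> genus_ge (Sp mu p : set V) k.
Proof.
move=> p0 kn m mk [g [gc gN g0]].
(* The absolute value changes nothing, [rq_den] being nonnegative, but makes [continuous_abs_powR]
   applicable. *)
pose N (x : V) := (`|rq_den mu p x| `^ p^-1)^-1 *: x.
have c0 (x : V) : x != 0 -> `|rq_den mu p x| `^ p^-1 != 0.
  by move=> x0; rewrite gt_eqF // powR_gt0 // normr_gt0 gt_eqF // rq_den_gt0.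
have SN (x : V) : x != 0 -> Sp mu p (N x).
  move=> x0; rewrite /Sp /= rq_denZ ger0_norm ?invr_ge0 ?powR_ge0 //.
  have {2}-> : rq_den mu p x = (`|rq_den mu p x| `^ p^-1) `^ p.
    by rewrite -powRrM mulVf ?gt_eqF // powRr1 // ger0_norm ?rq_den_ge0.
  by rewrite -powRM ?invr_ge0 ?powR_ge0 // mulVf ?c0 // powR1.
have Nc (x : V) : x != 0 -> {for x, continuous N}.
  move=> x0.
  have cd : {for x, continuous (fun y : V => `|rq_den mu p y| `^ p^-1)}.
    apply: (@continuous_comp V R R (rq_den mu p) (fun t : R => `|t| `^ p^-1)).
      exact: rq_den_continuous.
    by apply: continuous_abs_powR; rewrite invr_gt0.
  exact: (cvgZ (cvgV (c0 x x0) cd) cvg_id).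
have [|x x0|x x0|x x0] := @borsuk_ulam R n m (g \o N).
- exact: leq_trans mk kn.
- apply: (@cvg_within_comp _ _ _ _ _ (Sp mu p) _ _ _ (Nc x x0) _ _ gc).
    have : \forall y \near x, y != 0 
      by apply: filterS (cvgr_gt _ (@norm_continuous _ _ x) 0 _) => [y|]; rewrite normr_gt0.
    by apply: filterS => y; exact: SN.
  exact: SN.
- by rewrite /= /N rq_denN scalerN gN //; exact: SN.
- by move=> /eqP; apply/negP/g0/SN.
Qed.

Lemma Sp_Fk p k : 0 < p -> (k <= n)%N -> Fk mu p k (Sp mu p : set V).
Proof.
by move=> p0 kn; split; [exact: Sp_closed|exact: SpN| |exact: Sp_genus].
Qed.

Definition vspow (r : R) (f : V) : V := \row_i spow r (f 0 i).

Lemma vspow_continuous r : 0 < r -> continuous (vspow r).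
Proof.
move=> r0 x; apply: (@cvg_rV R V (nbhs x) (nbhs_filter x)) => j; rewrite mxE.
under eq_fun do rewrite mxE.
apply: (@continuous_comp V R R (fun f : V => f 0 j) (spow r)).
  exact: coord_continuous.
exact: spow_continuous.
Qed.

Lemma vspowN r f : vspow r (- f) = - vspow r f.
Proof. by apply/rowP => i; rewrite !mxE spowN. Qed.

Lemma vspowK r s : 0 < r -> 0 < s -> r * s = 1 -> cancel (vspow s) (vspow r).
Proof. by move=> r0 s0 rs f; apply/rowP => i; rewrite !mxE spow_spow. Qed.

Lemma rq_den_vspow p r f : 0 < r -> rq_den mu p (vspow r f) = rq_den mu (r * p) f.
Proof.
by move=> r0; apply: eq_bigr => i _; rewrite mxE abs_spow // -powRrM.
Qed.

(** The preimage is the image of B under the inverse [vspow (p / q)]. An odd map on it composes with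
    this inverse to one on B, so the genus does not drop. *)
Lemma Fk_vspow p q k B : 0 < p -> 0 < q -> Fk mu p k B ->
  Fk mu q k (vspow (q / p) @^-1` B).
Proof.
move=> p0 q0 [cB BN BS Bk].
have qp : 0 < q / p by rewrite divr_gt0.
have pq : 0 < p / q by rewrite divr_gt0.
have pqqp : q / p * (p / q) = 1 by rewrite mulrA divfK ?gt_eqF // divff ?gt_eqF.
have BT x : B x -> (vspow (q / p) @^-1` B) (vspow (p / q) x).
  by rewrite /= vspowK.
split.
- by apply: closed_comp => // x _; exact: vspow_continuous.
- by move=> x /= Bx; rewrite vspowN; exact: BN.
- by move=> x /= /BS; rewrite /Sp /= rq_den_vspow // divfK ?gt_eqF.
- move=> m mk [g [gc gN g0]]; apply: (Bk m mk); exists (g \o vspow (p / q)).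
  split => [|x /BT Bx|x /BT Bx] /=; last exact: g0.
    apply/subspace_continuousP => x Bx.
    apply: (@cvg_within_comp _ _ _ _ _ (vspow (q / p) @^-1` B) _ _
      (vspow (p / q) x) _ _ _ gc); last exact: BT.
      by apply: cvg_within_filter; exact: vspow_continuous.
    by rewrite near_withinE; apply: nearW => y; exact: BT.
  by rewrite vspowN gN.
Qed.

End Genus.

(** * Monotonicity in p *)

Section EdgeEstimates.
Local Open Scope classical_set_scope.
Variable R : realType.
Implicit Types (a b p q x y z : R).

Lemma powR_half z q : 0 <= z -> (z / 2) `^ q = 2 `^ (- q) * z `^ q.
Proof.
by move=> z0; rewrite powRM ?invr_ge0 // mulrC -[2^-1 in LHS]powR_inv1 // -powRrM mulN1r.
Qed.

(** Convexity of t^(q/p) at x^(p/q) and y^(p/q), then raised to the power p. *)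
Lemma powR_mean p q x y : 0 < p -> p <= q -> 0 <= x -> 0 <= y ->
  ((x `^ (p / q) + y `^ (p / q)) / 2) `^ q <= ((x + y) / 2) `^ p.
Proof.
move=> p0 pq x0 y0; have q0 : 0 < q := lt_le_trans p0 pq.
have h2 : 0 <= (2^-1 : R) <= 1 by rewrite invr_ge0 ler0n invf_le1 // ler1n.
have qp1 : 1 <= q / p by rewrite ler_pdivlMr // mul1r.
have hqp z : 0 <= z -> (z `^ (p / q)) `^ (q / p) = z.
  move=> z0; rewrite -powRrM mulrA divfK ?gt_eqF // divff ?gt_eqF // powRr1 //.
have cvx : ((x `^ (p / q) + y `^ (p / q)) / 2) `^ (q / p) <= (x + y) / 2.
  case/andP: h2 => h20 h21.
  have -> : (x `^ (p / q) + y `^ (p / q)) / 2 =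
      2^-1 * x `^ (p / q) + (1 - 2^-1) * y `^ (p / q) by lra.
  have -> : (x + y) / 2 = 2^-1 * (x `^ (p / q)) `^ (q / p) +
      (1 - 2^-1) * (y `^ (p / q)) `^ (q / p) by rewrite !hqp //; lra.
  by apply: (convex_powR qp1 (Itv01 h20 h21));
    rewrite ?inE /= ?in_itv /= ?andbT powR_ge0.
have := ge0_ler_powR (ltW p0) _ _ cvx; rewrite -powRrM divfK ?gt_eqF //.
by apply; rewrite nnegrE ?powR_ge0 // divr_ge0 // addr_ge0.
Qed.

(** For opposite signs |a - b| = |a| + |b| and the power mean inequality suffices. For equal signs
    the difference on the left is at most the larger signed power, which the error term absorbs. *)
Lemma spow_edge p q a b : 0 < p -> p <= q ->
  2 `^ (- q) * `|spow (p / q) a - spow (p / q) b| `^ q <=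
  2 `^ (- p) * `|a - b| `^ p + 2 `^ (- q) * (`|a| `^ p + `|b| `^ p).
Proof.
move=> p0 pq; have q0 : 0 < q := lt_le_trans p0 pq.
have r0 : 0 < p / q by rewrite divr_gt0.
have sym c d : `|spow (p / q) (- c) - spow (p / q) (- d)| =
               `|spow (p / q) c - spow (p / q) d|.
  by rewrite !spowN -opprD normrN.
wlog a0 : a b / 0 <= a.
  move=> H; have [|a0] := leP 0 a; first exact: H.
  have := H (- a) (- b); rewrite oppr_ge0 ltW // sym !normrN.
  by rewrite -[- a - - b]opprD normrN; apply.
have nn x y : 0 <= 2 `^ x * `|y| `^ p by rewrite mulr_ge0 ?powR_ge0.
have [b0|b0] := leP 0 b.
  apply: (@le_trans _ _ (2 `^ (- q) * (`|a| `^ p + `|b| `^ p))); last by rewrite lerDr.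
  rewrite ler_wpM2l ?powR_ge0 // !spow_ge0 //.
  have hq z : 0 <= z -> (z `^ (p / q)) `^ q = `|z| `^ p.
    by move=> z0; rewrite -powRrM divfK ?gt_eqF // ger0_norm.
  have le_pow x y : 0 <= x -> 0 <= y ->
      `|x `^ (p / q) - y `^ (p / q)| <= x `^ (p / q) -> 
      `|x `^ (p / q) - y `^ (p / q)| `^ q <= `|x| `^ p.
    move=> x0 y0 H; rewrite -hq //.
    by apply: ge0_ler_powR; rewrite ?nnegrE ?powR_ge0 ?(ltW q0).
  have [xy|yx] := leP (a `^ (p / q)) (b `^ (p / q)).
    apply: le_trans (_ : `|b| `^ p <= _); last by rewrite lerDr powR_ge0.
    rewrite distrC; apply: le_pow => //.
    by rewrite ger0_norm ?subr_ge0 // gerBl powR_ge0.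
  apply: le_trans (_ : `|a| `^ p <= _); last by rewrite lerDl powR_ge0.
  apply: le_pow => //.
  by rewrite ger0_norm ?subr_ge0 ?(ltW yx) // gerBl powR_ge0.
apply: (@le_trans _ _ (2 `^ (- p) * `|a - b| `^ p)); last first.
  by rewrite lerDl mulrDr addr_ge0.
have b0' : 0 <= - b by rewrite oppr_ge0 ltW.
rewrite -!powR_half // -[in leLHS](opprK b) spowN opprK !spow_ge0 //.
rewrite !ger0_norm ?addr_ge0 ?powR_ge0 //.
exact: powR_mean.
Qed.

Lemma abs_sub_powR p a b : 0 < p ->
  2 `^ (- p) * `|a - b| `^ p <= `|a| `^ p + `|b| `^ p.
Proof.
move=> p0; rewrite -powR_half //.
have le_pow x y : 0 <= x -> x <= `|y| -> x `^ p <= `|y| `^ p.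
  by move=> x0 xy; apply: ge0_ler_powR; rewrite ?nnegrE ?(ltW p0).
have ab := ler_normB a b.
have [ba|ab'] := leP `|b| `|a|.
  apply: le_trans (_ : `|a| `^ p <= _); last by rewrite lerDl powR_ge0.
  by apply: le_pow => //; rewrite ?divr_ge0 // ler_pdivrMr //; lra.
apply: le_trans (_ : `|b| `^ p <= _); last by rewrite lerDr powR_ge0.
by apply: le_pow => //; rewrite ?divr_ge0 // ler_pdivrMr //; lra.
Qed.

Lemma cvg_powR2N : 2 `^ (- p) @[p --> +oo] --> (0 : R).
Proof.
apply/cvgrPdist_lt => e e0.
have half1 : `|2^-1 : R| < 1 by rewrite ger0_norm ?invr_ge0 // invf_lt1 // ltr1n.
have /cvgrPdist_lt/(_ e e0)[N _ /(_ N (leqnn N))] /= := cvg_expr half1.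
rewrite sub0r normrN ger0_norm ?exprn_ge0 ?invr_ge0 // => He.
have := @nbhs_pinfty_ge R N%:R (num_real _); apply: filterS => p Np /=.
rewrite sub0r normrN ger0_norm ?powR_ge0 //; apply: le_lt_trans He.
rewrite exprVn -powR_invn //; apply: ler_powR; first by rewrite ler1n.
by rewrite lerN2.
Qed.

(** The limit is the infimum over p >= 1 of h(p) + C 2^{-p}, and c bounds these values from
    below. *)
Lemma lim_almost_decreasing (h : R -> R) (C c : R) : 0 < c -> 0 <= C ->
  (forall p q, 1 <= p -> p <= q -> h q <= h p + C * 2 `^ (- p)) ->
  (forall p, 1 <= p -> c - C * 2 `^ (- p) <= h p) ->
  lim (h p @[p --> +oo]) != 0.
Proof.
move=> c0 C0 hle hge.
pose A := [set h p + C * 2 `^ (- p) | p in [set p | 1 <= p]].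
have lbA : lbound A c.
  by move=> _ [p /= p1 <-]; rewrite -lerBlDr; exact: hge.
have A0 : A !=set0 by exists (h 1 + C * 2 `^ (-1)); exists 1 => //=; exact: lexx.
have infA : has_inf A by split => //; exists c.
have cl : c <= inf A by exact: lb_le_inf.
suff hl : h p @[p --> +oo] --> inf A.
  by rewrite (cvg_lim _ hl) // gt_eqF // (lt_le_trans c0).
have hlow p : 1 <= p -> inf A - C * 2 `^ (- p) <= h p.
  move=> p1; rewrite lerBlDr; apply: ge_inf; first by exists c.
  by exists p.
have C2 : C * 2 `^ (- p) @[p --> +oo] --> 0.
  by rewrite -[0](mulr0 C); exact: (cvgM (cvg_cst _) cvg_powR2N).
apply/cvgrPdist_lt => e e0.
have [_ [p0 /= p01 <-] Hp0] := inf_adherent e0 infA.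
have /cvgrPdist_lt/(_ e e0) := C2.
apply: filterS3 (@nbhs_pinfty_ge R 1 (num_real _)) (@nbhs_pinfty_ge R p0 (num_real _)).
move=> p p1 p0p /=; rewrite sub0r normrN ger0_norm ?mulr_ge0 ?powR_ge0 // => Ce.
have H1 := hlow p p1; have H2 := hle p0 p p01 p0p.
rewrite ltr_norml; lra.
Qed.

End EdgeEstimates.

(** * Cut-off eigenvalues and edge covers *)

Section CutoffEigenvalues.
Local Open Scope classical_set_scope.
Variables (R : realType) (n : nat) (adj : rel 'I_n).
Variables (w sigma : 'I_n -> 'I_n -> R) (mu kappa : 'I_n -> R).
Hypothesis w_pos : forall i j, adj i j -> 0 < w i j.
Hypothesis mu_pos : forall i, 0 < mu i.
Hypothesis sigma_pm : forall i j, adj i j -> sigma i j = 1 \/ sigma i j = -1.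
Local Notation V := 'rV[R]_n.
Local Notation num := (rq_num adj w sigma kappa).
Local Notation lambda := (lambda_p adj w sigma kappa mu).
Implicit Types (p q : R) (f : V) (B : set V) (k : nat).

Let edge_form p f := \sum_(i < n) \sum_(j < n | (i < j)%N && adj i j)
  w i j * `|f ord0 i - sigma i j * f ord0 j| `^ p.
Let pot p f := \sum_(i < n) kappa i * `|f ord0 i| `^ p.
(** On S_p each |f(i)|^p is at most M, as mu_i |f(i)|^p <= 1; K then bounds the potential term. In
    C, 2WM absorbs the edge errors and 2K the potentials at two exponents. *)
Let M := \sum_(i < n) (mu i)^-1.
Let W := \sum_(i < n) \sum_(j < n | (i < j)%N && adj i j) w i j.
Let K := (\sum_(i < n) `|kappa i|) * M.
Let C := 2 * (W * M) + 2 * K.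

Let M_ge0 : 0 <= M.
Proof. by apply: sumr_ge0 => i _; rewrite invr_ge0 ltW. Qed.

Let W_ge0 : 0 <= W.
Proof.
by apply: sumr_ge0 => i _; apply: sumr_ge0 => j /andP[_ /w_pos/ltW].
Qed.

Let K_ge0 : 0 <= K.
Proof. by rewrite mulr_ge0 //; exact: sumr_ge0. Qed.

Let WM_ge0 : 0 <= W * M.
Proof. by rewrite mulr_ge0. Qed.

Let C_ge0 : 0 <= C.
Proof. by rewrite /C addr_ge0 // mulr_ge0. Qed.

Let coord_Sp p f i : Sp mu p f -> `|f ord0 i| `^ p <= M.
Proof.
rewrite /Sp /= /rq_den => Sf.
have {}Sf : mu i * `|f ord0 i| `^ p <= 1.
  rewrite -Sf (bigD1 i) //= lerDl; apply: sumr_ge0 => j _.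
  by rewrite mulr_ge0 ?powR_ge0 // ltW.
apply: (@le_trans _ _ (mu i)^-1); first by rewrite -[leRHS]mulr1 ler_pdivlMl.
by rewrite /M (bigD1 i) //= lerDl; apply: sumr_ge0 => j _; rewrite invr_ge0 ltW.
Qed.

Let pot_Sp p f : Sp mu p f -> `|pot p f| <= K.
Proof.
move=> Sf; apply: le_trans (ler_norm_sum _ _ _) _; rewrite /K mulr_suml.
apply: ler_sum => i _; rewrite normrM ler_wpM2l //.
by rewrite ger0_norm ?powR_ge0 // coord_Sp.
Qed.

Let sigma_norm i j x : adj i j -> `|sigma i j * x| = `|x|.
Proof. by move=> /sigma_pm[]->; rewrite ?mul1r // mulN1r normrN. Qed.

Let sigma_spow r i j x : adj i j -> sigma i j * spow r x = spow r (sigma i j * x).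
Proof. by move=> /sigma_pm[]->; rewrite ?mul1r // !mulN1r spowN. Qed.

Let edge_form_vspow p q f : 0 < p -> p <= q -> Sp mu p f ->
  2 `^ (- q) * edge_form q (vspow (p / q) f) <=
  2 `^ (- p) * edge_form p f + 2 `^ (- q) * (2 * (W * M)).
Proof.
move=> p0 pq Sf.
have -> : 2 `^ (- q) * (2 * (W * M)) = \sum_(i < n) \sum_(j < n | (i < j)%N && adj i j)
    w i j * (2 `^ (- q) * (M + M)).
  by under eq_bigr do rewrite -mulr_suml; rewrite -mulr_suml -/W; ring.
rewrite !mulr_sumr -big_split /=; apply: ler_sum => i _; rewrite !mulr_sumr -big_split /=.
apply: ler_sum => j /andP[_ ij]; rewrite !mxE sigma_spow //.
rewrite ![2 `^ _ * (w i j * _)]mulrCA -mulrDr ler_wpM2l ?(ltW (w_pos ij)) //.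
apply: le_trans (spow_edge _ _ p0 pq) _.
rewrite lerD2l ler_wpM2l ?powR_ge0 // sigma_norm //.
by rewrite lerD ?coord_Sp.
Qed.

Let edge_form_ub p f : 0 < p -> Sp mu p f ->
  2 `^ (- p) * edge_form p f <= 2 * (W * M).
Proof.
move=> p0 Sf.
have -> : 2 * (W * M) = \sum_(i < n) \sum_(j < n | (i < j)%N && adj i j)
    w i j * (M + M).
  by under eq_bigr do rewrite -mulr_suml; rewrite -mulr_suml -/W; ring.
rewrite mulr_sumr; apply: ler_sum => i _; rewrite mulr_sumr.
apply: ler_sum => j /andP[_ ij].
rewrite mulrCA ler_wpM2l ?(ltW (w_pos ij)) //.
apply: le_trans (abs_sub_powR _ _ p0) _.
by rewrite sigma_norm // lerD ?coord_Sp.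
Qed.

Let edge_form_ge0 p f : 0 <= edge_form p f.
Proof.
apply: sumr_ge0 => i _; apply: sumr_ge0 => j /andP[_ /w_pos/ltW wij].
by rewrite mulr_ge0 ?powR_ge0.
Qed.

Let num_ge p f : Sp mu p f -> - K <= num p f.
Proof.
move=> /pot_Sp; rewrite ler_norml => /andP[Kp _].
by rewrite /rq_num -/(edge_form p f) -/(pot p f) ler_wpDl.
Qed.

Let num_le p f : 0 < p -> Sp mu p f -> 2 `^ (- p) * num p f <= 2 * (W * M) + 2 `^ (- p) * K.
Proof.
move=> p0 Sf; have /ler_normlP[_ Kp] := pot_Sp Sf.
rewrite /rq_num -/(edge_form p f) -/(pot p f) mulrDr lerD ?edge_form_ub //.
by rewrite ler_wpM2l ?powR_ge0.
Qed.

Let num_vspow p q f : 0 < p -> p <= q -> Sp mu p f ->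
  2 `^ (- q) * num q (vspow (p / q) f) <= 2 `^ (- p) * num p f + C * 2 `^ (- p).
Proof.
move=> p0 pq Sf; have q0 := lt_le_trans p0 pq.
have Sq : Sp mu q (vspow (p / q) f).
  by rewrite /Sp /= rq_den_vspow ?divr_gt0 // divfK // gt_eqF.
have /ler_normlP[_ Kq] := pot_Sp Sq.
have /ler_normlP[Kp _] := pot_Sp Sf.
have E := edge_form_vspow p0 pq Sf.
have qp : 2 `^ (- q) <= 2 `^ (- p) :> R by apply: ler_powR; rewrite ?ler1n // lerN2.
rewrite /rq_num -!/(edge_form _ _) -!/(pot _ _) !mulrDr /C.
have H1 := ler_wpM2l (powR_ge0 2 (- q)) Kq.
have H2 := ler_wpM2l (powR_ge0 2 (- p)) Kp.
have H3 := ler_wpM2r K_ge0 qp.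
have WM2 : 0 <= 2 * (W * M) by rewrite mulr_ge0.
have H4 := ler_wpM2r WM2 qp.
lra.
Qed.

Let rayleigh_Sp p f : Sp mu p f -> rayleigh adj w sigma kappa mu p f = num p f.
Proof. by rewrite /Sp /rayleigh /= => ->; rewrite divr1. Qed.

(** On the empty set a map into R^0 qualifies vacuously, so genus at least 1 forces a point. *)
Let Fk_nonempty p k B : Fk mu p k.+1 B -> B !=set0.
Proof.
case=> _ _ _ /(_ 0%N isT) Bk; apply: contrapT => /nonemptyPn B0; apply: Bk.
by exists (fun=> 0); split; rewrite B0 //; apply/subspace_continuousP.
Qed.

Let maxR p B := sup [set rayleigh adj w sigma kappa mu p f | f in B].

Let le_maxR p k B f : 0 < p -> Fk mu p k B -> B f -> num p f <= maxR p B.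
Proof.
move=> p0 [_ _ BS _] Bf; rewrite -(rayleigh_Sp (BS _ Bf)).
apply: ub_le_sup; last by exists f.
(* [sup] takes a default value on unbounded sets, hence this explicit upper bound. *)
exists ((2 * (W * M) + 2 `^ (- p) * K) * 2 `^ p) => _ [g Bg <-].
rewrite rayleigh_Sp; last exact: BS.
rewrite -ler_pdivrMr ?powR_gt0 // -powRN mulrC.
by apply: num_le => //; exact: BS.
Qed.

Let maxR_le p k B x : Fk mu p k.+1 B -> (forall f, B f -> num p f <= x) -> maxR p B <= x.
Proof.
move=> FB H; apply: ge_sup.
  by have [f Bf] := Fk_nonempty FB; exists (rayleigh adj w sigma kappa mu p f), f.
by case: (FB) => _ _ BS _ _ [f Bf <-]; rewrite rayleigh_Sp; [exact: H|exact: BS].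
Qed.

Let lambda_le p k B : 0 < p -> Fk mu p k.+1 B -> lambda p k.+1 <= maxR p B.
Proof.
move=> p0 FB; apply: ge_inf; last by exists B.
exists (- K) => _ [B' FB' <-]; have [f Bf] := Fk_nonempty FB'.
apply: le_trans (le_maxR p0 FB' Bf); apply: num_ge.
by case: FB' => _ _ BS _; exact: BS.
Qed.

(** Borsuk-Ulam enters here: S_p itself is admissible, so the infimum is not over an empty
    family. *)
Let le_lambda p k x : 0 < p -> (k < n)%N ->
  (forall B, Fk mu p k.+1 B -> x <= maxR p B) -> x <= lambda p k.+1.
Proof.
move=> p0 kn H; apply: lb_le_inf; last by move=> _ [B FB <-]; exact: H.
by exists (maxR p (Sp mu p)), (Sp mu p) => //; exact: Sp_Fk.
Qed.

(** Each competitor B at p yields one at q through [Fk_vspow], and [num_vspow] compares their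
    maxima. *)
Let lambda_almost_decreasing p q k : 0 < p -> p <= q -> (k < n)%N ->
  2 `^ (- q) * lambda q k.+1 <= 2 `^ (- p) * lambda p k.+1 + C * 2 `^ (- p).
Proof.
move=> p0 pq kn; have q0 := lt_le_trans p0 pq.
have p2 : 0 < 2 `^ p :> R by rewrite powR_gt0.
have q2 : 0 < 2 `^ q :> R by rewrite powR_gt0.
rewrite -lerBlDr [leRHS]mulrC [X in _ <= _ * X]powRN ler_pdivlMr //.
apply: le_lambda => // B FB; have FB' := Fk_vspow p0 q0 FB.
rewrite -ler_pdivlMr // lerBlDr powRN ler_pdivrMl //.
apply: le_trans (lambda_le q0 FB') _; apply: maxR_le FB' _ => f /= Bf.
have -> : f = vspow (p / q) (vspow (q / p) f).
  by rewrite vspowK ?divr_gt0 // mulrA divfK ?gt_eqF // divff // gt_eqF.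
rewrite -ler_pdivrMl // -powRN; case: (FB) => _ _ BS _.
apply: le_trans (num_vspow p0 pq (BS _ Bf)) _.
by rewrite -powRN lerD2r mulrC ler_wpM2r ?powR_ge0 // (le_maxR p0 FB Bf).
Qed.

(** * Lower bound from an edge cover *)

Variable cover : {set 'I_n * 'I_n}.
Hypothesis coverP : is_edge_cover adj cover.

(** Y dominates every 1/w_e. The bound below is 1/(Z + 1), positive without a proof that Z is
    nonzero. *)
Let Y := \sum_(i < n) \sum_(j < n | (i < j)%N && adj i j) (w i j)^-1.
Let Z := Y * \sum_(i < n) mu i.

Let Y_ge0 : 0 <= Y.
Proof.
by apply: sumr_ge0 => i _; apply: sumr_ge0 => j /andP[_ /w_pos/ltW]; rewrite invr_ge0.
Qed.

Let Z_ge0 : 0 <= Z.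
Proof. by rewrite mulr_ge0 //; apply: sumr_ge0 => i _; exact: ltW. Qed.

Let cover_map f : 'rV[R]_#|cover| :=
  \row_t (f ord0 (enum_val t).1 + sigma (enum_val t).1 (enum_val t).2 * f ord0 (enum_val t).2).

Let cover_map_continuous : continuous cover_map.
Proof.
move=> x; apply: (@cvg_rV R V (nbhs x) (nbhs_filter x)) => t; rewrite mxE.
under eq_fun do rewrite mxE.
exact: (cvgD (@coord_continuous R 1 n ord0 _ x)
  (cvgM (cvg_cst _) (@coord_continuous R 1 n ord0 _ x))).
Qed.

(* At a zero of cover_map the two ends of every covering edge e satisfy
   f(i) = - sigma f(j), so e alone contributes w_e |f(i)|^p = w_e |f(j)|^p. *)
Let cover_map_zero p f : 0 < p -> Sp mu p f -> cover_map f = 0 ->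
  (Z + 1)^-1 <= 2 `^ (- p) * edge_form p f.
Proof.
move=> p0 Sf cf.
have edge i j : (i, j) \in cover -> f ord0 i = - (sigma i j * f ord0 j).
  move=> ij; have /rowP/(_ (enum_rank_in ij (i, j))) := cf.
  by rewrite !mxE enum_rankK_in //= => /eqP; rewrite addr_eq0 => /eqP.
case/andP: coverP => /'forall_implyP covE /forallP covV.
pose a := 2 `^ (- p) * edge_form p f.
have a_ge0 : 0 <= a by rewrite mulr_ge0 ?powR_ge0.
have va v : `|f ord0 v| `^ p <= Y * a.
  have /existsP[[i j] /andP[/= ij vij]] := covV v.
  have /= /andP[lij aij] := covE _ ij.
  have fij : `|f ord0 i| = `|f ord0 j| by rewrite (edge _ _ ij) normrN sigma_norm.
  have -> : `|f ord0 v| = `|f ord0 i| by case/orP: vij => /eqP <-.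
  have fa : w i j * `|f ord0 i| `^ p <= a.
    rewrite /a /edge_form (bigD1 i) //= (bigD1 j) ?lij //= -addrA mulrDr.
    rewrite ler_wpDr //.
      rewrite mulr_ge0 ?powR_ge0 // addr_ge0 //; last first.
        apply: sumr_ge0 => i' _; apply: sumr_ge0 => j' /andP[_ /w_pos/ltW ?].
        by rewrite mulr_ge0 ?powR_ge0.
      apply: sumr_ge0 => j' /andP[/andP[_ /w_pos/ltW ?] _].
      by rewrite mulr_ge0 ?powR_ge0.
    (* As f(i) - sigma f(j) = 2 f(i), the factor 2^p cancels the normalisation. *)
    rewrite mulrCA ler_wpM2l ?(ltW (w_pos aij)) // -powR_half //.
    have -> : sigma i j * f ord0 j = - f ord0 i by rewrite (edge _ _ ij) opprK.
    have -> : f ord0 i - - f ord0 i = f ord0 i * 2 by ring.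
    by rewrite normrM (ger0_norm (ler0n _ 2)) mulfK ?pnatr_eq0.
  apply: (@le_trans _ _ ((w i j)^-1 * a)).
    by rewrite ler_pdivlMl ?w_pos.
  rewrite ler_wpM2r // /Y (bigD1 i) //= (bigD1 j) ?lij //= -addrA lerDl addr_ge0 //.
    by apply: sumr_ge0 => j' /andP[/andP[_ /w_pos/ltW ?] _]; rewrite invr_ge0.
  apply: sumr_ge0 => i' _; apply: sumr_ge0 => j' /andP[_ /w_pos/ltW ?].
  by rewrite invr_ge0.
have aZ : 1 <= a * Z.
  move: Sf; rewrite /Sp /= /rq_den => <-; rewrite /Z mulrA [a * Y]mulrC mulr_sumr.
  by apply: ler_sum => v _; rewrite [leLHS]mulrC ler_wpM2r ?va ?ltW.
by rewrite -[leLHS]mul1r ler_pdivrMr ?ltr_wpDl // mulrDr mulr1 (le_trans aZ) // lerDl.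
Qed.

Let lambda_lower_bound p k : 0 < p -> (k < n)%N -> (#|cover| <= k)%N ->
  (Z + 1)^-1 - C * 2 `^ (- p) <= 2 `^ (- p) * lambda p k.+1.
Proof.
move=> p0 kn ck; have p2 : 0 < 2 `^ p :> R by rewrite powR_gt0.
rewrite [leRHS]mulrC [X in _ <= _ * X]powRN ler_pdivlMr //; apply: le_lambda => // B FB.
rewrite -ler_pdivlMr // -powRN.
(* Genus at least k + 1 > [#|cover|] rules out a nonvanishing odd map into that dimension, so
   [cover_map] has a zero on B. *)
have [f [Bf cf]] : exists f, B f /\ cover_map f = 0.
  apply: contrapT => H; case: (FB) => _ _ _ /(_ #|cover| ck); apply.
  exists cover_map; split.
  - exact/continuous_subspaceT/cover_map_continuous.
  - by move=> x _; apply/rowP => t; rewrite !mxE mulrN opprD.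
  - by move=> x Bx; apply/eqP => cx; apply: H; exists x.
case: (FB) => _ _ BS _; have Sf := BS _ Bf.
have /ler_normlP[Kp _] := pot_Sp Sf.
have := cover_map_zero p0 Sf cf.
have H1 := ler_wpM2r (powR_ge0 2 (- p)) (le_maxR p0 FB Bf).
have H2 := ler_wpM2l (powR_ge0 2 (- p)) Kp.
have H3 : 0 <= 2 `^ (- p) * K by rewrite mulr_ge0 ?powR_ge0.
have H4 : 0 <= 2 `^ (- p) * (W * M) by rewrite mulr_ge0 ?powR_ge0.
move: H1; rewrite /rq_num -/(edge_form p f) -/(pot p f) /C.
lra.
Qed.

Lemma cutoff_L_neq0 k : (k < n)%N -> (#|cover| <= k)%N ->
  cutoff_L adj w sigma kappa mu k.+1 != 0.
Proof.
move=> kn ck; rewrite /cutoff_L.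
apply: (@lim_almost_decreasing R _ C (Z + 1)^-1) => //.
- by rewrite invr_gt0 ltr_wpDl.
- by move=> p q p1 pq; apply: lambda_almost_decreasing => //; exact: lt_le_trans p1.
- by move=> p p1; apply: lambda_lower_bound => //; exact: lt_le_trans p1.
Qed.

End CutoffEigenvalues.

(** The maximum over signatures becomes a bound for each sigma; [k : 'I_n] stands for the eigenvalue
    number k + 1. *)
Theorem theorem6p3 (R : realType) (n : nat) (adj : rel 'I_n)
  (adj_sym : symmetric adj) (adj_irr : irreflexive adj)
  (no_isolated : forall i : 'I_n, exists j : 'I_n, adj i j)
  (w : 'I_n -> 'I_n -> R) (w_pos : forall i j, adj i j -> 0 < w i j)
  (mu : 'I_n -> R) (mu_pos : forall i, 0 < mu i)
  (kappa : 'I_n -> R) :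
  forall sigma : 'I_n -> 'I_n -> R,
    (forall i j, adj i j -> sigma i j = 1 \/ sigma i j = -1) ->
    (#|[set k : 'I_n | cutoff_L adj w sigma kappa mu k.+1 == (0 : R)%R]|
       <= edge_cover_number adj)%N.
Proof.
move=> sigma sigma_pm; rewrite /edge_cover_number.
apply: (big_ind (fun m => #|_| <= m)%N) => [|a b Ha Hb|cover coverP].
(* The default n * n of the minimum also bounds the count, which is at most n. *)
- rewrite (leq_trans (max_card _)) // card_ord.
  by case: (n) => // n'; rewrite leq_pmulr.
- by rewrite leq_min Ha.
(* A cover with at least n edges is trivial; otherwise every vanishing index lies below
   [#|cover|]. *)
have [nc|cn] := leqP n #|cover|.
  by rewrite (leq_trans (max_card _)) // card_ord.
have widen_inj : injective (widen_ord (ltnW cn)).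
  by move=> i j /(congr1 val) /= ij; exact: val_inj.
rewrite -[leqRHS]card_ord -cardsT -(card_imset _ widen_inj).
apply: subset_leq_card; apply/fintype.subsetP => k; rewrite inE => Lk.
have kc : (k < #|cover|)%N.
  rewrite ltnNge; apply: contraL Lk => ck.
  exact: (cutoff_L_neq0 kappa w_pos mu_pos sigma_pm coverP (ltn_ord k) ck).
by apply/imsetP; exists (Ordinal kc) => //; exact: val_inj.
Qed.
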